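(* For every estimator $(\hat W_n)_{n\ge1}$ of the tail probability $W_n$ there exist a continuous distribution on $\mathbb{R}$ with cumulative distribution function $F^\star$, a real number $\epsilon>0$, and a strictly increasing sequence $(n_k)_{k=1,2,\ldots}$ of positive integers, such that for all $k\ge1$: $$\mathbf{P}_{F^\star}\left\{\left|\frac{\hat W_{n_k}(Y_1,\ldots,Y_{n_k})}{W_{n_k}}-1\right|>\epsilon\right\}>\epsilon .$$ In particular, it is impossible to perform distribution-free PAC-learning of the tail probability in relative error, i.e. no estimator PAC-learns $W_n$ in relative error with respect to the family of all continuous distributions on $\mathbb{R}$.
   Context: For a continuous probability distribution on $\mathbb{R}$ with cumulative distribution function $F$, $\mathbf{P}_F$ denotes probability when $Y_1,Y_2,\ldots$ are i.i.d. with distribution function $F$. The tail probability is $$W_n=1-F\left(\max_{1\le i\le n}Y_i\right),$$ the probability that a new sample exceeds the maximum of the first $n$ samples. An estimator is a sequence of measurable functions $\hat W_n:\mathbb{R}^n\to[0,1]$, $n\ge1$ (not depending on $F$). An estimator PAC-learns the tail probability in relative error with respect to a family $\mathcal{F}$ of continuous distributions if for every $F\in\mathcal{F}$ and every $\epsilon,\delta>0$ there exists $n_0(F,\epsilon,\delta)$ such that for all $n>n_0(F,\epsilon,\delta)$, $\mathbf{P}_F\{|\hat W_n/W_n-1|<\epsilon\}>1-\delta$. The learning is distribution-free if $\mathcal{F}$ consists of all continuous distributions on $\mathbb{R}$. *)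

(* Defs.v *)
From HB Require Import structures.
From mathcomp Require Import all_boot all_order all_algebra.
From mathcomp Require Import all_classical all_reals all_analysis.

Set Implicit Arguments.
Unset Strict Implicit.
Unset Printing Implicit Defensive.

Import Order.TTheory GRing.Theory Num.Theory.
Import numFieldNormedType.Exports.

Local Open Scope classical_set_scope.
Local Open Scope ring_scope.

Section iid_law.
Context {R : realType} {d : measure_display} {T : measurableType d}.

Definition cons_pair n (x : T * n.-tuple T) : n.+1.-tuple T :=
  [tuple of x.1 :: x.2].

Lemma measurable_cons_pair n : measurable_fun [set: T * n.-tuple T] (@cons_pair n).
Proof. exact: measurable_cons. Qed.

HB.instance Definition _ n :=
  isMeasurableFun.Build _ _ _ _ (@cons_pair n) (@measurable_cons_pair n).

(* The law of (Y_1, ..., Y_n) for Y_1, Y_2, ... i.i.d. with law mu; by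
   [iid_law_unique] it is the only law under which the coordinates are
   independent with common law mu. *)
Fixpoint iid_law (mu : probability T R) n : probability (n.-tuple T) R :=
  match n with
  | 0 => dirac [tuple]
  | m.+1 => distribution (mu \x iid_law mu m)%E (@cons_pair m)
  end.


Lemma iid_law_box (mu : probability T R) n (A : 'I_n -> set T) :
    (forall i, measurable (A i)) ->
  iid_law mu n [set y | forall i, A i (tnth y i)] =
  (\prod_(i < n) mu (A i))%E.
Proof.
elim: n A => [|n IH] A mA.
  rewrite big_ord0 /= (_ : [set _ | _] = setT) ?diracT//.
  by apply/seteqP; split => // y _ [].
rewrite big_ord_recl -IH//= /distribution /pushforward.
rewrite -product_measure1E//.
- congr product_measure1; apply/seteqP; split => [[x y]/= h|[x y]/= [h0 h] i].
    split; first exact: (h ord0).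
    by move=> i; have := h (lift ord0 i); rewrite tnthS.
  by case: (unliftP ord0 i) => [j ->|->//]; rewrite tnthS.
- rewrite (_ : [set _ | _] =
      \bigcap_(i in [set: 'I_n]) ((fun y => tnth y i) @^-1` A (lift ord0 i))).
    apply: fin_bigcap_measurable => // i _.
    by rewrite -[X in measurable X]setTI; exact: measurable_tnth.
  by apply/seteqP; split => [y h i _|y h i]; exact: h.
Qed.

Lemma iid_law_unique (mu : probability T R) n
    (nu : probability (n.-tuple T) R) :
    (forall A : 'I_n -> set T, (forall i, measurable (A i)) ->
      nu [set y | forall i, A i (tnth y i)] = (\prod_(i < n) mu (A i))%E) ->
  forall B, measurable B -> nu B = iid_law mu n B.
Proof.
move=> nuE.
pose G : set (set (n.-tuple T)) :=
  [set B | exists2 A : 'I_n -> set T, (forall i, measurable (A i)) &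
     B = [set y | forall i, A i (tnth y i)]].
apply: (@measure_unique _ _ _ G (fun=> setT)).
- apply/seteqP; split.
    apply: smallest_sub; first exact: smallest_sigma_algebra.
    case: n @G nu nuE => [|n] G nu nuE; first by rewrite big_ord0.
    rewrite -bigcup_mkord_ord; apply: bigcup_sub => i _ _ [C mC <-].
    apply: sub_sigma_algebra; exists (fun j => if j == inord i then C else setT).
      by move=> j; case: ifP.
    rewrite setTI; apply/seteqP; split => [y /= Cy j|y /= /(_ (inord i))].
      by case: eqP => [->|].
    by rewrite eqxx.
  apply: smallest_sub; first exact: sigma_algebra_measurable.
  move=> _ [A mA ->].
  rewrite (_ : [set _ | _] =
      \bigcap_(i in [set: 'I_n]) ((fun y => tnth y i) @^-1` A i)).
    apply: fin_bigcap_measurable => // i _.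
    by rewrite -[X in measurable X]setTI; exact: measurable_tnth.
  by apply/seteqP; split => [y h i _|y h i]; exact: h.
- move=> _ _ [A mA ->] [B mB ->]; exists (fun i => A i `&` B i).
    by move=> i; exact: measurableI.
  by apply/seteqP; split => [y [hA hB] i|y h]; [split|split => i; case: (h i)].
- by move=> _; exists (fun=> setT) => //; apply/seteqP; split.
- by rewrite bigcup_const.
- by move=> _ [A mA ->]; exact: etrans (nuE A mA) (esym (iid_law_box mu mA)).
- by move=> _; apply: le_lt_trans (ltry 1); exact: probability_le1.
Qed.

End iid_law.

Section tail_probability.
Context {R : realType}.

Definition dist_fun (mu : probability R R) (x : R) : R := fine (mu `]-oo, x]%classic).

Definition continuous_dist : set (probability R R) :=
  [set mu | continuous (dist_fun mu)].

(* For n > 0 the default [head 0 y] is the first sample; n = 0 is never used. *)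
Definition sample_max n (y : n.-tuple R) : R :=
  \big[Num.max/head 0 y]_(x <- y) x.

Definition tail_prob (mu : probability R R) n (y : n.-tuple R) : R :=
  1 - dist_fun mu (sample_max y).

Definition estimator (What : forall n, n.-tuple R -> R) :=
  forall n, (0 < n)%N ->
    measurable_fun setT (What n) /\ forall y, 0 <= What n y <= 1.

(* W_n vanishes only on an event of probability 0 when the distribution is
   continuous, so the convention x / 0 = 0 does not affect any probability. *)
Definition rel_error (What : forall n, n.-tuple R -> R)
    (mu : probability R R) n (y : n.-tuple R) : R :=
  `|What n y / tail_prob mu y - 1|.

Definition PAC_learns (What : forall n, n.-tuple R -> R)
    (F : set (probability R R)) :=
  forall mu, F mu -> forall eps delta : R, 0 < eps -> 0 < delta ->
    exists n0 : nat, forall n, (n0 < n)%N ->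
      (iid_law mu n [set y | (rel_error What mu y < eps)%R] > (1 - delta)%:E)%E.

End tail_probability.

(* Main.v *)
(* Let [T j] be the mass above the integer [j] of a distribution that is uniform
   on each block [(j, j+1]].  Take [T k.+1 = (1 + b k) / 16 ^ k.+1] for bits [b],
   and [n = 2 * 16 ^ k], so that [T k] and [T k.+1] are of order [1/n].  Compare
   two bit sequences that agree before [k] and differ at [k].  The distribution
   with the smaller [T k.+1] dominates the other one below [k.+1], hence gives at
   least the same probability to every event of samples below [k.+1].  With
   probability at least 1/4 the maximum of [n] samples of the other distribution
   lies in [(k+1/2, k+1]]; there the two values of the tail probability are too far
   apart for one estimate to fit both.  So the estimator errs at time [n] under one
   of the two distributions, whatever the bits after [k], and the bits can be
   chosen one by one so that it errs for every [k]. *)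

From HB Require Import structures.
Require Import Defs.
From mathcomp Require Import all_boot all_order all_algebra.
From mathcomp Require Import all_classical all_reals all_analysis.
From mathcomp Require Import measurable_realfun ring lra.

Import Order.TTheory GRing.Theory Num.Theory.
Import numFieldNormedType.Exports.

Local Open Scope classical_set_scope.
Local Open Scope ring_scope.

(** * Measurability of the sample maximum and of the relative error *)

(** The inverse is continuous on the open complement of 0, and on the singleton of 0 every function
    is measurable. *)
Lemma measurable_inv (R : realType) : measurable_fun setT (@GRing.inv R).
Proof.
rewrite -(setUv [set (0 : R)]); apply/measurable_funU => //.
  exact: measurableC.
split; first exact: measurable_fun_set1.
apply: open_continuous_measurable_fun.
  by rewrite openC; exact: closed_eq.
by move=> x; rewrite inE => /= /eqP x0; exact: inv_continuous.
Qed.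

Lemma sample_max_le (R : realType) n (y : n.-tuple R) (x : R) :
  (0 < n)%N -> (sample_max y <= x) = [forall i, tnth y i <= x].
Proof.
case: n y => // n y _; rewrite /sample_max big_tuple.
apply/bigmax_leP/forallP => [[_ h] i|h]; first exact: h.
split=> [|i _]; last exact: h.
(* The default value [head 0 y] of the maximum is itself an entry, since the tuple is nonempty. *)
by have := h ord0; rewrite (tnth_nth 0) -nth0; case: y {h} => -[].
Qed.

Lemma measurable_cube d (T : measurableType d) n (A : set T) :
  measurable A -> measurable [set y : n.-tuple T | forall i, A (tnth y i)].
Proof.
move=> mA; rewrite (_ : [set _ | _] =
    \bigcap_(i in [set: 'I_n]) ((fun y => tnth y i) @^-1` A)).
  apply: fin_bigcap_measurable => // i _.
  by rewrite -[X in measurable X]setTI; exact: measurable_tnth.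
by apply/seteqP; split => [y h i _|y h i]; exact: h.
Qed.

Lemma measurable_sample_max (R : realType) n :
  (0 < n)%N -> measurable_fun setT (@sample_max R n).
Proof.
move=> n0; apply: (measurability _ (RGenOInfty.measurableE R)).
move=> _ [_ [x ->] <-]; rewrite setTI.
rewrite (_ : _ @^-1` _ = ~` [set y | forall i, `]-oo, x]%classic (tnth y i)]).
  by apply: measurableC; exact: measurable_cube.
rewrite -[LHS]setCK; congr (~` _); apply/seteqP; split => y /=;
  rewrite in_itv/= andbT.
  move=> /negP; rewrite -leNgt (sample_max_le _ _ _ _ n0) => /forallP h i.
  by rewrite in_itv/=.
move=> h; apply/negP; rewrite -leNgt (sample_max_le _ _ _ _ n0).
by apply/forallP => i; have := h i; rewrite in_itv.
Qed.

Lemma measurable_rel_error (R : realType) (What : forall n, n.-tuple R -> R)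
    (mu : probability R R) n : estimator What -> continuous_dist mu ->
  (0 < n)%N -> measurable_fun setT (@rel_error R What mu n).
Proof.
move=> estW cmu n0.
apply: measurableT_comp => //; apply: measurable_funB => //.
apply: measurable_funM; first exact: (estW n n0).1.
apply: (measurableT_comp (measurable_inv R)).
apply: measurable_funB => //.
apply: (measurableT_comp (continuous_measurable_fun cmu)).
exact: measurable_sample_max.
Qed.

(** * Comparison of sample laws under two distributions *)

(* Swapping the order of integration turns the monotonicity of an integral in its
   measure into the monotonicity in its integrand. *)
Lemma iid_law_mono (R : realType) d (T : measurableType d)
    (mu nu : probability T R) (A : set T) :
    (forall B, measurable B -> B `<=` A -> (mu B <= nu B)%E) ->
  forall n (B : set (n.-tuple T)), measurable B ->
    (forall y, B y -> forall i, A (tnth y i)) ->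
    (iid_law mu n B <= iid_law nu n B)%E.
Proof.
move=> munu; elim=> [//|n IH] B mB BA.
rewrite /= /distribution /pushforward.
set C := _ @^-1` B.
have mC : measurable C.
  by rewrite -[C]setTI; exact: (@measurable_cons_pair _ _ n).
have CA x y : C (x, y) -> A x /\ forall i, A (tnth y i).
  move=> /BA h; split; first exact: (h ord0).
  by move=> i; have := h (lift ord0 i); rewrite tnthS.
pose P := iid_law mu n; pose Q := iid_law nu n.
have swapE (m : probability T R) : (m \x Q)%E C = (m \x^ Q)%E C.
  by apply: product_measure_unique => // X Y mX mY; exact: product_measure2E.
(* The hybrid [mu \x Q] changes one factor at a time: the induction hypothesis compares the sections
   at a fixed first sample, and [munu] those at fixed remaining samples. *)
apply: (@le_trans _ _ ((mu \x Q)%E C)).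
  apply: ge0_le_integral => //.
  - exact: measurable_fun_xsection.
  - exact: measurable_fun_xsection.
  - move=> x _; apply: IH; first exact: measurable_xsection.
    by move=> y; rewrite /xsection/= inE => /CA[].
rewrite !swapE; apply: ge0_le_integral => //.
- exact: measurable_fun_ysection.
- exact: measurable_fun_ysection.
- move=> y _; apply: munu; first exact: measurable_ysection.
  by move=> x; rewrite /ysection/= inE => /CA[].
Qed.

(** A union bound splits [E] into a part in [G] and a part in [H]. The second part consists of
    samples in [A], so its probability can only grow when [mu] is replaced by [nu]. *)
Lemma two_point_bound (R : realType) d (T : measurableType d)
    (mu nu : probability T R) (A : set T) n (E G H : set (n.-tuple T)) :
    (forall B, measurable B -> B `<=` A -> (mu B <= nu B)%E) ->
    measurable E -> (forall y, E y -> forall i, A (tnth y i)) ->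
    measurable G -> measurable H -> E `<=` G `|` H ->
  (iid_law mu n E <= iid_law mu n G + iid_law nu n H)%E.
Proof.
move=> munu mE EA mG mH EGH.
have mEH : measurable (E `&` H) by exact: measurableI.
apply: (@le_trans _ _ (iid_law mu n (G `|` (E `&` H)))).
  apply: le_measure; rewrite ?inE//; first exact: measurableU.
  by move=> y Ey; case: (EGH _ Ey); [left|right].
apply: le_trans (measureU2 _ mG mEH) _.
rewrite leeD2l//; apply: (@le_trans _ _ (iid_law nu n (E `&` H))).
  by apply: (iid_law_mono _ _ _ _ _ _ munu) => // y [/EA].
by apply: le_measure; rewrite ?inE// => y [].
Qed.

(** * Distributions that are uniform on each integer block *)

Section real_lebesgue.
Context {R : realType}.

(* [lebesgue_measure] is a measure on [measurableTypeR R], which has the same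
   measurable sets as [R] but another display. *)
Definition real_lebesgue : set R -> \bar R := @lebesgue_measure R.

Let real_lebesgue0 : real_lebesgue set0 = 0%E. Proof. exact: measure0. Qed.

Let real_lebesgue_ge0 A : (0 <= real_lebesgue A)%E.
Proof. exact: measure_ge0. Qed.

Let real_lebesgue_sigma_additive : semi_sigma_additive real_lebesgue.
Proof. exact: (@measure_semi_sigma_additive _ _ _ (@lebesgue_measure R)). Qed.

HB.instance Definition _ := isMeasure.Build _ _ _ real_lebesgue
  real_lebesgue0 real_lebesgue_ge0 real_lebesgue_sigma_additive.

Lemma real_lebesgue_itvoc (a b : R) :
  a <= b -> real_lebesgue `]a, b] = (b - a)%:E.
Proof.
rewrite /real_lebesgue lebesgue_measure_itv/= lte_fin.
by case: ltgtP => // -> _; rewrite subrr.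
Qed.

End real_lebesgue.

Definition is_tail {R : realType} (T : nat -> R) :=
  [/\ T 0 = 1, forall j, T j.+1 <= T j & T n @[n --> \oo] --> 0].

Section piecewise_uniform.
Context {R : realType}.
Variable T : nat -> R.
Hypothesis tailT : is_tail T.

Let T0 : T 0 = 1. Proof. by case: tailT. Qed.

Let T_noninc j : T j.+1 <= T j. Proof. by case: tailT. Qed.

Let T_cvg0 : T n @[n --> \oo] --> 0. Proof. by case: tailT. Qed.

Let weight_ge0 j : 0 <= T j - T j.+1.
Proof. by rewrite subr_ge0. Qed.

Let piece j : {measure set R -> \bar R} :=
  mscale (NngNum (weight_ge0 j))
    (mrestr (@real_lebesgue R) (measurable_itv `]j%:R, j.+1%:R])).

(* The distribution with density [T j - T j.+1] on [(j, j+1]], so that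
   [T j] is the probability of exceeding [j]. *)
Definition piecewise_uniform : set R -> \bar R := mseries piece 0.

HB.instance Definition _ := Measure.on piecewise_uniform.

Lemma piecewise_uniformE B : piecewise_uniform B =
  (\sum_(0 <= j <oo) (T j - T j.+1)%:E *
     real_lebesgue (B `&` `]j%:R, j.+1%:R]))%E.
Proof. by []. Qed.

Let term_ge0 B j : (0 <= (T j - T j.+1)%:E *
  real_lebesgue (B `&` `](j%:R : R), j.+1%:R]))%E.
Proof. by rewrite mule_ge0// lee_fin. Qed.

Let sum_weight k : (\sum_(0 <= j < k) (T j - T j.+1)%:E = (1 - T k)%:E)%E.
Proof.
rewrite sumEFin; congr EFin; elim: k => [|k IH].
  by rewrite big_nil T0 subrr.
by rewrite big_nat_recr//= IH; ring.
Qed.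

Let leb_block j : real_lebesgue (`](j%:R : R), j.+1%:R]%classic) = 1%E.
Proof.
rewrite real_lebesgue_itvoc ?ler_nat//.
by rewrite -natrB// subSnn.
Qed.

Let piecewise_uniform_setT : piecewise_uniform setT = 1%E.
Proof.
rewrite piecewise_uniformE; apply/cvg_lim => //.
under eq_fun do under eq_bigr do rewrite setTI leb_block mule1.
under eq_fun do rewrite sum_weight.
apply: cvg_EFin; first by near=> x.
rewrite (_ : _ \o _ = (fun k => 1 - T k)); last by apply/funext.
by rewrite -[X in _ --> X]subr0; apply: cvgB => //; exact: cvg_cst.
Unshelve. all: by end_near. Qed.

HB.instance Definition _ :=
  Measure_isProbability.Build _ _ _ piecewise_uniform piecewise_uniform_setT.

Let T_ge0 j : 0 <= T j.
Proof.
rewrite -(cvg_lim _ T_cvg0)//; apply: limr_le => //.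
  by apply/cvg_ex; exists 0.
near=> n; have : (j <= n)%N by near: n; exact: nbhs_infty_ge.
by move/(nonincreasing_seqP T).1 : T_noninc; apply.
Unshelve. all: by end_near. Qed.

Let T_le1 j : T j <= 1.
Proof. by elim: j => [|j]; [rewrite T0|exact/le_trans]. Qed.

(** The blocks are disjoint and the density on each of them is at most 1. *)
Lemma piecewise_uniform_le_lebesgue B : measurable B ->
  (piecewise_uniform B <= real_lebesgue B)%E.
Proof.
move=> mB; rewrite piecewise_uniformE.
set I := fun j : nat => B `&` `]j%:R, j.+1%:R].
have mI j : measurable (I j) by exact: measurableI.
apply: (@le_trans _ _ (\sum_(0 <= j <oo) real_lebesgue (I j))%E).
  apply: lee_nneseries => // j _.
  rewrite -[leRHS]mul1e lee_wpmul2r// lee_fin.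
  by have := T_ge0 j.+1; have := T_le1 j; lra.
rewrite -measure_semi_bigcup//.
- apply: le_measure; rewrite ?inE//; first exact: bigcup_measurable.
  by move=> x [j _ []].
- apply/trivIsetP => i j _ _ ij; apply/seteqP; split => // x [] [_ +] [_].
  rewrite /= !in_itv/= => /andP[ix xi] /andP[jx xj]; apply: (negP ij).
  have := lt_le_trans ix xj; have := lt_le_trans jx xi.
  by rewrite !ltr_nat !ltnS => ji ij'; rewrite eqn_leq ij' ji.
- exact: bigcup_measurable.
Qed.

(** The blocks before [k] telescope to [1 - T k], block [k] contributes in proportion to [x - k],
    and the later blocks miss the ray. *)
Lemma piecewise_uniform_itvNyc k (x : R) : k%:R < x <= k.+1%:R ->
  piecewise_uniform `]-oo, x] = (1 - T k + (T k - T k.+1) * (x - k%:R))%:E.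
Proof.
move=> /andP[kx xk]; rewrite piecewise_uniformE.
rewrite (nneseries_split 0 k.+1); last by move=> *; exact: term_ge0.
rewrite add0n [X in (_ + X)%E]eseries0 ?adde0; last first.
  move=> j kj _; rewrite (_ : _ `&` _ = set0) ?measure0 ?mule0//.
  apply/seteqP; split => // y [] /=; rewrite !in_itv/= => yx /andP[jy _].
  have : j%:R < k.+1%:R :> R by rewrite (lt_le_trans jy)// (le_trans yx).
  by rewrite ltr_nat ltnNge kj.
rewrite big_nat_recr//= [RHS]EFinD -sum_weight; congr (_ + _)%E.
  apply: eq_big_nat => j /andP[_ jk].
  rewrite (_ : _ `&` _ = `]j%:R, j.+1%:R]%classic) ?leb_block ?mule1//.
  apply/seteqP; split => y /=; first by case.
  rewrite !in_itv/= => /andP[jy yj]; split; last by rewrite jy.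
  by rewrite (le_trans yj)// ltW// (le_lt_trans _ kx)// ler_nat.
rewrite (_ : _ `&` _ = `]k%:R, x]%classic).
  by rewrite real_lebesgue_itvoc ?(ltW kx)// -EFinM.
apply/seteqP; split => y /=; rewrite !in_itv/=; first by case=> -> /andP[->].
by move=> /andP[-> yx]; rewrite yx (le_trans yx).
Qed.

Lemma dist_fun_piecewise_uniform k (x : R) : k%:R < x <= k.+1%:R ->
  dist_fun piecewise_uniform x = 1 - T k + (T k - T k.+1) * (x - k%:R).
Proof. by move=> /piecewise_uniform_itvNyc/(congr1 fine). Qed.

(** Domination by Lebesgue measure makes the distribution function 1-Lipschitz. *)
Lemma continuous_piecewise_uniform : continuous_dist piecewise_uniform.
Proof.
have incr (x y : R) : x <= y ->
    0 <= dist_fun piecewise_uniform y - dist_fun piecewise_uniform x <= y - x.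
  move=> xy; pose P : probability R R := piecewise_uniform.
  have sub : `]-oo, x] `<=` `]-oo, y]%classic.
    by move=> z /=; rewrite !in_itv/= => /le_trans; exact.
  have -> : dist_fun piecewise_uniform y - dist_fun piecewise_uniform x =
      fine (P (`]-oo, y] `\` `]-oo, x]%classic)).
    rewrite /dist_fun -/P.
    have mIy : measurable (`]-oo, y]%classic : set R) by exact: measurable_itv.
    have mIx : measurable (`]-oo, x]%classic : set R) by exact: measurable_itv.
    rewrite (measureDI P mIy mIx) (setIidr sub) fineD ?addrK//.
      by apply: fin_num_measure; exact: measurableD.
    by apply: fin_num_measure; exact: mIx.
  rewrite fine_ge0//= -lee_fin fineK; last first.
    by apply: fin_num_measure; exact: measurableD.
  apply: le_trans (piecewise_uniform_le_lebesgue _ _) _ => //.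
    exact: measurableD.
  rewrite (_ : _ `\` _ = `]x, y]%classic); last first.
    apply/seteqP; split => z /=; rewrite !in_itv/= -?ltNge.
      by case=> -> /negP; rewrite -ltNge => ->.
    by move=> /andP[xz ->]; split => //; apply/negP; rewrite -ltNge.
  by rewrite real_lebesgue_itvoc.
have lip (x y : R) : `|dist_fun piecewise_uniform x -
    dist_fun piecewise_uniform y| <= `|x - y|.
  wlog xy : x y / x <= y => [hw|].
    by case: (leP x y) => [|/ltW] /hw//; rewrite distrC [leRHS]distrC.
  have /andP[h1 h2] := incr _ _ xy.
  by rewrite distrC [leRHS]distrC !ger0_norm// subr_ge0.
move=> x; apply/cvgrPdist_le => e e0; near=> y.
apply: le_trans (lip x y) _.
by near: y; apply: cvgr_dist_le; [exact: cvg_id|].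
Unshelve. all: by end_near. Qed.

End piecewise_uniform.
Arguments piecewise_uniform {R T}.
Arguments piecewise_uniformE {R T}.
Arguments piecewise_uniform_itvNyc {R T}.
Arguments dist_fun_piecewise_uniform {R T}.
Arguments continuous_piecewise_uniform {R T}.

(** The densities agree before block [k], the one for [T] is at least as large on block [k], and [B]
    misses all later blocks. *)
Lemma piecewise_uniform_mono (R : realType) (S T : nat -> R)
    (tailS : is_tail S) (tailT : is_tail T) k :
    (forall j, (j <= k)%N -> S j = T j) -> T k.+1 <= S k.+1 ->
  forall B : set R, measurable B -> B `<=` `]-oo, k.+1%:R] ->
    (piecewise_uniform tailS B <= piecewise_uniform tailT B)%E.
Proof.
move=> ST TS B mB Bk; rewrite !piecewise_uniformE.
have S_noninc j : 0 <= S j - S j.+1 by case: tailS => _ h _; rewrite subr_ge0.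
apply: lee_nneseries => j *; first by rewrite mule_ge0// lee_fin.
have [jk|jk|->] := ltngtP j k.
- by rewrite (ST j (ltnW jk)) (ST j.+1 jk).
- rewrite (_ : B `&` _ = set0) ?measure0 ?mule0//.
  apply/seteqP; split => // x [/Bk/=]; rewrite !in_itv/= => xk /andP[jx _].
  by have := lt_le_trans jx xk; rewrite ltr_nat ltnNge jk.
- by rewrite lee_wpmul2r// lee_fin ST// lerB.
Qed.

(** * Probability that the maximum falls in the right half of a block *)

Lemma le_bernoulli (R : realFieldType) (x : R) n :
  -1 <= x -> 1 + n%:R * x <= (1 + x) ^+ n.
Proof.
move=> x1; elim: n => [|n IH]; first by rewrite mul0r addr0 expr0.
rewrite exprS; apply: (@le_trans _ _ ((1 + x) * (1 + n%:R * x))); last first.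
  by rewrite ler_wpM2l//; lra.
rewrite -natr1; have : 0 <= n%:R * (x * x) by rewrite mulr_ge0// -expr2 sqr_ge0.
by lra.
Qed.

Lemma iid_law_cube (R : realType) (mu : probability R R) n (A : set R) p :
  measurable A -> mu A = p%:E ->
  iid_law mu n [set y | forall i, A (tnth y i)] = (p ^+ n)%:E.
Proof.
move=> mA muA; rewrite (iid_law_box mu (A := fun=> A))// muA.
by rewrite prodEFin prodr_const card_ord.
Qed.

(* The left half is excluded because near [k] the tail probabilities of two
   distributions that agree below [k] are indistinguishable. *)
Definition max_in_right_half {R : realType} k n : set (n.-tuple R) :=
  [set y | forall i, `]-oo, k.+1%:R]%classic (tnth y i)] `\`
  [set y | forall i, `]-oo, k%:R + 2^-1]%classic (tnth y i)].

Lemma measurable_max_in_right_half (R : realType) k n :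
  measurable (@max_in_right_half R k n).
Proof. by apply: measurableD; exact: measurable_cube. Qed.

Lemma sample_max_right_half (R : realType) k n (y : n.-tuple R) :
  (0 < n)%N -> max_in_right_half k n y ->
  k%:R + 2^-1 < sample_max y <= k.+1%:R.
Proof.
move=> n0 [/= yk1 yk]; apply/andP; split.
  rewrite ltNge sample_max_le//; apply/negP => /forallP h; apply: yk => i.
  by rewrite in_itv/=.
rewrite sample_max_le//; apply/forallP => i.
by have := yk1 i; rewrite in_itv.
Qed.

(** The probability is [p ^+ n - q ^+ n], where [p] and [q] are the masses below [k + 1] and
    [k + 1/2]. Since [p = 1 - 1/(4n)] and [q <= 1 - 1/n], it is at least 3/4 - 1/2. *)
Lemma le_max_in_right_half (R : realType) (T : nat -> R) (tailT : is_tail T)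
    k n : (0 < n)%N -> 2 <= n%:R * T k -> n%:R * T k.+1 = 4^-1 ->
  ((4^-1 : R)%:E <=
    iid_law (piecewise_uniform tailT) n (max_in_right_half k n))%E.
Proof.
move=> n_gt0 Tk Tk1; pose N : R := n%:R.
have N1 : 1 <= N by rewrite ler1n.
have N0 : 0 < N by rewrite ltr0n.
have k1 : k.+1%:R = k%:R + 1 :> R by rewrite -natr1.
have kE (x : R) : 0 < x -> x <= 1 ->
    piecewise_uniform tailT `]-oo, k%:R + x] =
    (1 - T k + (T k - T k.+1) * x)%:E.
  move=> x0 x1; rewrite (piecewise_uniform_itvNyc tailT k); last first.
    by rewrite ltrDl x0/= k1 lerD2l.
  by congr (_ + _ * _)%:E; ring.
have sub : [set y : n.-tuple R | forall i, `]-oo, k%:R + 2^-1]%classic (tnth y i)]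
    `<=` [set y | forall i, `]-oo, k.+1%:R]%classic (tnth y i)].
  move=> y h i; have := h i; rewrite /= !in_itv/= k1; lra.
pose P : probability R R := piecewise_uniform tailT.
have e1 : iid_law P n [set y | forall i, `]-oo, k.+1%:R]%classic (tnth y i)] =
    ((1 - T k + (T k - T k.+1) * 1) ^+ n)%:E.
  by apply: iid_law_cube => //; rewrite k1; apply: kE.
have e2 : iid_law P n [set y | forall i, `]-oo, k%:R + 2^-1]%classic (tnth y i)]
    = ((1 - T k + (T k - T k.+1) * 2^-1) ^+ n)%:E.
  by apply: iid_law_cube => //; apply: kE; lra.
have -> : iid_law (piecewise_uniform tailT) n (max_in_right_half k n) =
    (((1 - T k + (T k - T k.+1) * 1) ^+ n)%:E -
    ((1 - T k + (T k - T k.+1) * 2^-1) ^+ n)%:E)%E.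
  rewrite -e1 -e2 -(setIidr sub); apply: measureD.
  - by apply: measurable_cube; exact: measurable_itv.
  - by apply: measurable_cube; exact: measurable_itv.
  - by move: e1 => /= ->; exact: ltry.
rewrite -EFinB lee_fin.
set p := 1 - T k + _ * 1; set q := 1 - T k + _.
have pE : p = 1 + - (4 * N)^-1.
  have -> : (4 * N)^-1 = T k.+1 by rewrite invfM -Tk1 mulrC mulKf ?gt_eqF.
  by rewrite /p; ring.
have h1 : 3/4 <= p ^+ n.
  have := @le_bernoulli R (- (4 * N)^-1) n.
  rewrite -pE -/N.
  have -> : N * - (4 * N)^-1 = - 4^-1 by field; rewrite gt_eqF.
  have : (4 * N)^-1 <= 1 by rewrite invf_le1; lra.
  lra.
have h2 : q <= 1 - N^-1.
  rewrite /q -(ler_pM2l N0) !mulrBr mulrDr mulrBr mulrA mulrBr mulfV ?gt_eqF//.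
  by rewrite -/N in Tk Tk1; lra.
have q0 : 0 <= q.
  have : piecewise_uniform tailT `]-oo, k%:R + 2^-1] = q%:E by apply: kE; lra.
  by move=> qE; rewrite -lee_fin -qE; exact: measure_ge0.
have h3 : q ^+ n <= 2^-1.
  have h4 : q ^+ n <= (1 - N^-1) ^+ n by rewrite lerXn2r// nnegrE; lra.
  have h5 := @le_bernoulli R N^-1 n.
  rewrite -/N mulfV ?gt_eqF// in h5.
  have N10 : 0 < N^-1 by rewrite invr_gt0.
  have N11 : N^-1 <= 1 by rewrite invf_le1.
  (* Bernoulli gives [(1 + 1/n) ^+ n >= 2]; the product bound turns this into
     [(1 - 1/n) ^+ n <= 1/2]. *)
  have h6 : (1 - N^-1) ^+ n * (1 + N^-1) ^+ n <= 1.
    rewrite -exprMn exprn_ile1//; first by rewrite mulr_ge0//; lra.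
    by have := sqr_ge0 N^-1; rewrite expr2; lra.
  have h7 : 0 <= (1 - N^-1) ^+ n by rewrite exprn_ge0//; lra.
  have : (1 - N^-1) ^+ n * 2 <= 1.
    by apply: le_trans h6; rewrite ler_wpM2l//; lra.
  lra.
by lra.
Qed.

(** * Failure under one of two distributions *)

(** Here [a] is [n * T k] and [s] is the position of the maximum within block [k]. The scaled tails
    differ by [s / 8 > 1/16] while [N * W <= 33/16], so [(101/100) W < (99/100) W'] and no [v] fits
    between. *)
Lemma rel_error_separation (R : realFieldType) (N a s v W W' : R) :
    0 < N -> 2 <= a <= 4 -> 2^-1 < s <= 1 ->
    N * W = a - (a - 8^-1) * s -> N * W' = a - (a - 4^-1) * s ->
  `|v / W - 1| <= 100^-1 -> `|v / W' - 1| <= 100^-1 -> False.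
Proof.
move=> N0 /andP[a2 a4] /andP[s2 s1] NW NW'.
(* These products are nonlinear facts handed to [lra]: [as1] bounds [N * W] from above, [as2] makes
   [W] and [W'] positive. *)
have as1 : 0 <= (a - 8^-1) * (s - 2^-1) by rewrite mulr_ge0//; lra.
have as2 : 0 <= a * (1 - s) by rewrite mulr_ge0//; lra.
have W0 : 0 < W by rewrite -(pmulr_rgt0 _ N0) NW; lra.
have W'0 : 0 < W' by rewrite -(pmulr_rgt0 _ N0) NW'; lra.
rewrite !ler_norml !lerBlDr !lerBrDr => /andP[_ vW] /andP[vW' _].
rewrite ler_pdivrMr// -(ler_pM2l N0) mulrCA NW in vW.
rewrite ler_pdivlMr// -(ler_pM2l N0) mulrCA NW' in vW'.
by lra.
Qed.

(** If both failure probabilities were at most 1/100, [two_point_bound] would give 1/4 <= 2/100. *)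
Lemma estimator_fails_at_one_of_two (R : realType)
    (What : forall n, n.-tuple R -> R) (S T : nat -> R)
    (tailS : is_tail S) (tailT : is_tail T) k n :
    estimator What -> (0 < n)%N -> (forall j, (j <= k)%N -> S j = T j) ->
    2 <= n%:R * T k <= 4 -> n%:R * T k.+1 = 8^-1 -> n%:R * S k.+1 = 4^-1 ->
  (100^-1%:E < iid_law (piecewise_uniform tailT) n
     [set y | (rel_error What (piecewise_uniform tailT) y > 100^-1)%R])%E \/
  (100^-1%:E < iid_law (piecewise_uniform tailS) n
     [set y | (rel_error What (piecewise_uniform tailS) y > 100^-1)%R])%E.
Proof.
move=> estW n0 ST Tk Tk1 Sk1.
have N0 : 0 < n%:R :> R by rewrite ltr0n.
have Sk : S k = T k by exact: ST.
pose fail V (tailV : is_tail V) : set (n.-tuple R) :=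
  [set y | (rel_error What (piecewise_uniform tailV) y > 100^-1)%R].
have mfail V tailV : measurable (@fail V tailV).
  rewrite (_ : fail V tailV = setT `&`
      rel_error What (piecewise_uniform tailV) (n:=n) @^-1` `]100^-1, +oo[).
    apply: measurable_rel_error => //; exact: continuous_piecewise_uniform.
  by rewrite setTI; apply/seteqP; split => y; rewrite /= in_itv/= andbT.
have cover : max_in_right_half k n `<=` fail _ tailS `|` fail _ tailT.
  move=> y /(sample_max_right_half _ _ _ _ n0) /andP[yk yk1].
  case: (ltP 100^-1 (rel_error What (piecewise_uniform tailS) y)) => [|eS].
    by left.
  right; rewrite /fail/= ltNge; apply/negP => eT; move: eT eS.
  have k1 : k.+1%:R = k%:R + 1 :> R by rewrite -natr1.
  have kyk : k%:R < sample_max y <= k.+1%:R by rewrite yk1 (lt_trans _ yk)// ltrDl.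
  apply: (rel_error_separation _ n%:R (n%:R * T k) (sample_max y - k%:R)) => //.
  - by rewrite ltrBrDl yk/= lerBlDl -k1.
  - rewrite /tail_prob (dist_fun_piecewise_uniform tailT _ _ kyk) -Tk1; ring.
  - rewrite /tail_prob (dist_fun_piecewise_uniform tailS _ _ kyk) -Sk1 -Sk; ring.
have TS : T k.+1 <= S k.+1 by rewrite -(ler_pM2l N0) Tk1 Sk1; lra.
have := two_point_bound _ _ _ _ _ _ _ _ _ _
  (piecewise_uniform_mono _ _ _ tailS tailT _ ST TS)
  (measurable_max_in_right_half R k n) _ (mfail _ tailS) (mfail _ tailT) cover.
move=> /(_ (fun y h => h.1)) le1.
have le2 : ((4^-1)%:E <= iid_law (piecewise_uniform tailS) n
    (max_in_right_half k n))%E.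
  by apply: le_max_in_right_half => //; rewrite Sk; case/andP: Tk.
apply/orP; rewrite orbC -implyNb; apply/implyP; rewrite -leNgt => failS.
rewrite ltNge; apply/negP => failT.
have := le_trans (le_trans le2 le1) (leeD failS failT).
by rewrite -EFinD lee_fin; lra.
Qed.

(** * Tails indexed by bit sequences *)

Section binary_tail.
Context {R : realType}.

Definition binary_tail (b : nat -> bool) (j : nat) : R :=
  if j is i.+1 then (1 + (b i)%:R) / 16 ^+ j else 1.

Let binary_tail_bounds b j : (16 ^+ j)^-1 <= binary_tail b j <= 2 * (16 ^+ j)^-1.
Proof.
case: j => [|j] /=; first by rewrite expr0 invr1; apply/andP; split; lra.
have h : 0 < (16 ^+ j.+1)^-1 :> R by rewrite invr_gt0 exprn_gt0.
by apply/andP; split; case: (b j) => /=; lra.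
Qed.

Lemma is_tail_binary_tail b : is_tail (binary_tail b).
Proof.
split=> // [j|].
  have /andP[_ h1] := binary_tail_bounds b j.+1.
  have /andP[h2 _] := binary_tail_bounds b j.
  (* Base 16 absorbs the factor 2 between the two values of a bit, so the tail decreases whatever
     the bits are. *)
  apply: le_trans h1 (le_trans _ h2); rewrite exprS invfM.
  have : 0 < (16 ^+ j)^-1 :> R by rewrite invr_gt0 exprn_gt0.
  lra.
have geo c : c * (16 ^+ n)^-1 @[n --> \oo] --> (0 : R).
  under eq_fun do rewrite -exprVn.
  by apply: cvg_geometric; rewrite ger0_norm ?invr_ge0// invf_lt1; lra.
have /(_ 1) := geo; under eq_fun do rewrite mul1r; move=> geo1.
by apply: (squeeze_cvgr _ geo1 (geo 2)); near=> n; exact: binary_tail_bounds.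
Unshelve. all: by end_near. Qed.

Lemma binary_tail_scale b k : 2 <= (2 * 16 ^ k)%:R * binary_tail b k <= 4.
Proof.
have /andP[h1 h2] := binary_tail_bounds b k.
have h : 0 < 16 ^+ k :> R by rewrite exprn_gt0.
rewrite -(ler_pM2l h) mulfV ?gt_eqF// in h1.
rewrite -(ler_pM2l h) mulrCA mulfV ?gt_eqF// in h2.
by rewrite natrM natrX -mulrA; apply/andP; split; lra.
Qed.

Lemma binary_tail_scaleS b k :
  (2 * 16 ^ k)%:R * binary_tail b k.+1 = (1 + (b k)%:R) / 8.
Proof.
rewrite natrM natrX /= exprS; field.
by rewrite expf_neq0.
Qed.

(** Index [j.+1] reads bit [j], so agreement of the bits strictly before [k] reaches the tails up to
    and including [k]. *)
Lemma eq_binary_tail b b' k : (forall j, (j < k)%N -> b j = b' j) ->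
  forall j, (j <= k)%N -> binary_tail b j = binary_tail b' j.
Proof. by move=> bb' [//|j] jk; rewrite /= bb'. Qed.

End binary_tail.

(** * Choice of the bits and conclusion *)

(* Whatever the later bits, one of the two values of bit [k] forces [P _ k],
   so the bits can be fixed one after the other. *)
Lemma diagonal_bits (P : (nat -> bool) -> nat -> Prop) :
    (forall k b b', (forall j, (j < k)%N -> b j = b' j) ->
      ~~ b k -> b' k -> P b k \/ P b' k) ->
  exists b, forall k, P b k.
Proof.
move=> Pbb'.
(* Bit [k] is set exactly when some sequence with the same earlier bits and bit [k] unset violates
   [P] at [k]. That sequence then forces [P] for every continuation with the bit set; if there is
   none, leaving the bit unset is safe. *)
pose g k (b : nat -> bool) := `[< exists b0 : nat -> bool,
  [/\ forall j, (j < k)%N -> b0 j = b j, ~~ b0 k & ~ P b0 k] >].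
pose B := fix B k := if k is i.+1
  then (fun j => if j == i then g i (B i) else B i j) else (fun=> false).
pose b k := B k.+1 k.
have BE i k : (i < k)%N -> B k i = b i.
  elim: k => // k IH; rewrite ltnS leq_eqVlt => /predU1P[<-|ik]; first by [].
  have -> : B k.+1 i = B k i by rewrite /= ltn_eqF.
  exact: IH.
(* [g k] reads only the bits below [k], where stage [B k] already agrees with the limit [b]. *)
have bE k : b k = g k b.
  rewrite /b /= eqxx; congr asbool; apply/propext.
  by split => -[b0 [b0E nb0 nP]]; exists b0; split => // j jk;
    rewrite b0E//; have := BE _ _ jk.
exists b => k; apply: contrapT => nPbk.
have [bk|nbk] := boolP (b k).
  have := bk; rewrite bE => /asboolP[b0 [b0b nb0 nP]].
  by case: (Pbb' k b0 b b0b nb0 bk).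
suff : g k b by rewrite -bE (negbTE nbk).
by apply/asboolP; exists b.
Qed.

Theorem theorem9 (R : realType) :
  (forall What : (forall n, n.-tuple R -> R), estimator What ->
    exists (mu : probability R R) (eps : R) (n_ : nat -> nat),
      [/\ continuous_dist mu, 0 < eps,
          {homo n_ : i j / (i < j)%N},
          forall k, (0 < k)%N -> (0 < n_ k)%N &
          forall k, (0 < k)%N ->
            (iid_law mu (n_ k) [set y | (rel_error What mu y > eps)%R]
               > eps%:E)%E])
  /\
  (forall What : (forall n, n.-tuple R -> R), estimator What ->
    ~ PAC_learns What continuous_dist).
Proof.
have fails (What : forall n, n.-tuple R -> R) : estimator What ->
    exists (mu : probability R R) (eps : R) (n_ : nat -> nat),
      [/\ continuous_dist mu, 0 < eps,
          {homo n_ : i j / (i < j)%N},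
          forall k, (0 < k)%N -> (0 < n_ k)%N &
          forall k, (0 < k)%N ->
            (iid_law mu (n_ k) [set y | (rel_error What mu y > eps)%R]
               > eps%:E)%E].
  move=> estW.
  pose n_ k := (2 * 16 ^ k)%N.
  have n0 k : (0 < n_ k)%N by rewrite muln_gt0 expn_gt0.
  pose mu b : probability R R := piecewise_uniform (is_tail_binary_tail b).
  have [b failb] : exists b, forall k, ((100^-1)%:E < iid_law (mu b) (n_ k)
      [set y | (rel_error What (mu b) y > 100^-1)%R])%E.
    apply: diagonal_bits => k b b' bb' nbk b'k.
    (* The sequence [b], with bit [k] unset, plays the role of [T], and [b'] that of [S]. *)
    apply: (estimator_fails_at_one_of_two _ _ _ _ _ _ k) => //.
    - by move=> j jk; rewrite (eq_binary_tail _ _ _ bb').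
    - exact: binary_tail_scale.
    - by rewrite binary_tail_scaleS (negbTE nbk) addr0 mul1r.
    - by rewrite binary_tail_scaleS b'k mulr1n; lra.
  exists (mu b), 100^-1, n_; split => //.
  - exact: continuous_piecewise_uniform.
  - by move=> i j ij; rewrite ltn_pmul2l// ltn_exp2l.
split=> // What estW pac.
have [mu [eps [n_ [cmu eps0 n_mono n_gt0 failmu]]]] := fails _ estW.
(* With accuracy and confidence both [eps], success has probability above [1 - eps], yet the
   disjoint failure event has probability above [eps]. *)
have [m mP] := pac mu cmu eps eps eps0 eps0.
have n_ge k : (k <= n_ k)%N.
  by elim: k => // k IH; apply: leq_ltn_trans IH _; exact: n_mono.
(* The index [m.+1] is positive, and [n_ m.+1] exceeds the threshold [m]. *)
have := mP _ (n_ge m.+1); have := failmu m.+1 isT.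
set n := n_ m.+1; have n0 : (0 < n)%N := n_gt0 m.+1 isT.
have mrel := measurable_rel_error _ _ _ _ estW cmu n0.
set G := [set y | _ < eps]; set H := [set y | _] => HP GP.
have mG : measurable G.
  rewrite (_ : G = setT `&` rel_error What mu (n:=n) @^-1` `]-oo, eps[%classic).
    exact: mrel.
  by rewrite setTI; apply/seteqP; split => y; rewrite /= in_itv.
have mH : measurable H.
  rewrite (_ : H = setT `&` rel_error What mu (n:=n) @^-1` `]eps, +oo[%classic).
    exact: mrel.
  by rewrite setTI; apply/seteqP; split => y; rewrite /= in_itv/= andbT.
have HGC : (iid_law mu n H <= iid_law mu n (~` G))%E.
  apply: le_measure; rewrite ?inE//; first exact: measurableC.
  by move=> y /= hy; apply/negP; rewrite -leNgt ltW.
have := lt_le_trans HP HGC; rewrite probability_setC//.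
move: GP; rewrite -(fineK (fin_num_measure (iid_law mu n) _ mG)).
by rewrite -EFinB !lte_fin; lra.
Qed.
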